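(* Let $\mathbf{V}_\star\in\mathbb{C}^n$ be a solution of the power flow equations $[\![\mathbf{V}_\star]\!]\,\overline{\mathbf{Y}(\mathbf{V}_\star-\mathbf{V}^0)}=\mathbf{S}_\star$ with injection vector $\mathbf{S}_\star\in\mathbb{C}^n$ (all entries of $\mathbf{V}_\star$ nonzero). Define $$\mathbf{Z}_\star=[\![\overline{\mathbf{V}_\star}]\!]^{-1}\,\overline{\mathbf{Y}}^{-1}\,[\![\mathbf{V}_\star]\!]^{-1},\qquad \mathbf{J}_\star=\begin{pmatrix}\mathbf{I} & \overline{\mathbf{Z}_\star}\,[\![\overline{\mathbf{S}_\star}]\!]\\ \mathbf{Z}_\star[\![\mathbf{S}_\star]\!] & \mathbf{I}\end{pmatrix},$$ assume $\mathbf{J}_\star$ is nonsingular, and write its inverse in $n\times n$ blocks as $$\mathbf{J}_\star^{-1}=\begin{pmatrix}\mathbf{M}_\star & \mathbf{N}_\star\\ \overline{\mathbf{N}_\star} & \overline{\mathbf{M}_\star}\end{pmatrix}.$$ Let $\mathbf{S}\in\mathbb{C}^n$ and $r>0$ be arbitrary and put $\Delta\mathbf{S}=\mathbf{S}-\mathbf{S}_\star$. If $$\begin{aligned}&\frac1r\left\|\mathbf{M}_\star\overline{\mathbf{Z}_\star}\,\overline{\Delta\mathbf{S}}+\mathbf{N}_\star\mathbf{Z}_\star\Delta\mathbf{S}\right\|+\left\|\mathbf{J}_\star^{-1}\right\|\left\|\mathbf{Z}_\star[\![\mathbf{S}]\!]\right\|r\\ &+\left\|\mathbf{M}_\star\overline{\mathbf{Z}_\star}[\![\overline{\Delta\mathbf{S}}]\!]+\mathbf{N}_\star[\![\mathbf{Z}_\star\Delta\mathbf{S}]\!]\right\|+\left\|\mathbf{M}_\star[\![\overline{\mathbf{Z}_\star\Delta\mathbf{S}}]\!]+\mathbf{N}_\star\mathbf{Z}_\star[\![\Delta\mathbf{S}]\!]\right\|\le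 1,\end{aligned}$$ then the power flow equations $[\![\mathbf{V}]\!]\,\overline{\mathbf{Y}(\mathbf{V}-\mathbf{V}^0)}=\mathbf{S}$ have a solution $\mathbf{V}\in\mathbb{C}^n$. Further, if $r<1$, there is such a solution satisfying $$\frac{|V_{\star i}|}{1+r}\le |V_i|\le\frac{|V_{\star i}|}{1-r},\qquad i=1,\dots,n.$$
   Context: Setting: a power network with one slack bus (index $0$, fixed voltage) and $n$ PQ buses, without shunt elements. $\mathbf{Y}\in\mathbb{C}^{n\times n}$ is the sub-matrix of the bus admittance matrix corresponding to the PQ buses; it is nonsingular. $\mathbf{V}^0=V^0\mathbf{1}\in\mathbb{C}^n$ is the constant vector all of whose entries equal the fixed complex number $V^0$ (the zero-injection voltage). For an injection vector $\mathbf{S}\in\mathbb{C}^n$, the power flow equations in the unknown $\mathbf{V}\in\mathbb{C}^n$ are $[\![\mathbf{V}]\!]\,\overline{\mathbf{Y}(\mathbf{V}-\mathbf{V}^0)}=\mathbf{S}$. Notation: $[\![\mathbf{x}]\!]$ is the diagonal matrix with diagonal $\mathbf{x}\in\mathbb{C}^n$; the overline denotes entrywise complex conjugation; $\mathbf{1}$ is the all-ones vector; $\mathbf{I}$ is the $n\times n$ identity matrix. For vectors, $\|\mathbf{x}\|=\max_i|x_i|$; for matrices, $\|\mathbf{A}\|=\max_i\sum_j|A_{ij}|$ (also for the $2n\times 2n$ matrix $\mathbf{J}_\star^{-1}$). *)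

(* Defs.v *)
From mathcomp Require Import all_boot all_order all_algebra.
From mathcomp Require Import reals.
From mathcomp Require Export complex.

Set Implicit Arguments.
Unset Strict Implicit.
Unset Printing Implicit Defensive.

Import Order.TTheory GRing.Theory Num.Theory.

Local Open Scope ring_scope.

Section Definitions.
Variable R : realType.
Local Notation C := R[i].

(* R-valued modulus; `|z| is the same number, but as an element of R[i]. *)
Definition cmod (z : C) : R := Normc.normc z.

Definition vnorm n (x : 'cV[C]_n) : R := \big[Num.max/0]_(i < n) cmod (x i 0).

Definition mnorm m n (A : 'M[C]_(m, n)) : R :=
  \big[Num.max/0]_(i < m) \sum_(j < n) cmod (A i j).

Definition conj_entries m n (A : 'M[C]_(m, n)) : 'M[C]_(m, n) := map_mx (@conjc R) A.

Definition diagc n (x : 'cV[C]_n) : 'M[C]_n := diag_mx x^T.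

Definition power_flow n (Y : 'M[C]_n) (v0 : C) (S V : 'cV[C]_n) : Prop :=
  diagc V *m conj_entries (Y *m (V - const_mx v0)) = S.

Definition Zmx n (Y : 'M[C]_n) (V : 'cV[C]_n) : 'M[C]_n :=
  invmx (diagc (conj_entries V)) *m invmx (conj_entries Y) *m invmx (diagc V).

Definition Jmx n (Z : 'M[C]_n) (S : 'cV[C]_n) : 'M[C]_(n + n) :=
  block_mx 1%:M (conj_entries Z *m diagc (conj_entries S))
           (Z *m diagc S) 1%:M.

(* The upper blocks of the inverse; the lower ones are their conjugates, in
   the opposite order (see [invmx_Jmx]). *)
Definition Mmx n (J : 'M[C]_(n + n)) : 'M[C]_n := ulsubmx (invmx J).
Definition Nmx n (J : 'M[C]_(n + n)) : 'M[C]_n := ursubmx (invmx J).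

Lemma conj_entriesK m n : involutive (@conj_entries m n).
Proof. by move=> A; apply/matrixP=> i j; rewrite !mxE conjcK. Qed.

Lemma conj_entriesM m n p (A : 'M[C]_(m, n)) (B : 'M[C]_(n, p)) :
  conj_entries (A *m B) = conj_entries A *m conj_entries B.
Proof. exact: map_mxM. Qed.

Lemma conj_entriesD m n (A B : 'M[C]_(m, n)) :
  conj_entries (A + B) = conj_entries A + conj_entries B.
Proof. exact: map_mxD. Qed.

Lemma conj_entries_diagc n (x : 'cV[C]_n) : conj_entries (diagc x) = diagc (conj_entries x).
Proof. by rewrite /conj_entries /diagc map_diag_mx map_trmx. Qed.

Lemma invmx_Jmx n (Z : 'M[C]_n) (S : 'cV[C]_n) : Jmx Z S \in unitmx ->
  let M := Mmx (Jmx Z S) in let N := Nmx (Jmx Z S) in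
  invmx (Jmx Z S) = block_mx M N (conj_entries N) (conj_entries M).
Proof.
rewrite /Mmx /Nmx /Jmx -conj_entries_diagc -conj_entriesM; move: (Z *m _) => A.
move=> uJ /=; set J := block_mx _ _ _ _ in uJ *.
set a := ulsubmx _; set b := ursubmx _.
set c := dlsubmx (invmx J); set d := drsubmx (invmx J).
have eK : invmx J = block_mx a b c d by rewrite submxK.
have := mulmxV uJ; rewrite eK {1}/J mulmx_block !mul1mx (@scalar_mx_block _ n n).
case/eq_block_mx=> e1 e2 e3 e4.
have /(congr1 (mulmx (invmx J))) :
    J *m block_mx (conj_entries d) (conj_entries c) (conj_entries b) (conj_entries a) = 1%:M.
  have h (B B' D : 'M[C]_n) : B + B' = D -> conj_entries B' + conj_entries B = conj_entries D.
    by move=> <-; rewrite -conj_entriesD addrC.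
  move/h: e1; move/h: e2; move/h: e3; move/h: e4.
  rewrite !conj_entriesM conj_entriesK /conj_entries !map_mx1 !map_mx0 => e4 e3 e2 e1.
  by rewrite mulmx_block !mul1mx (@scalar_mx_block _ n n) e1 e2 e3 e4.
by rewrite mulKmx // mulmx1 eK => /eq_block_mx[_ _ <- <-].
Qed.

End Definitions.

(* Main.v *)
Require Import Defs.
From mathcomp Require Import all_boot all_order all_algebra lra ring.
From mathcomp Require Import classical_sets.
From mathcomp Require Import reals complex.

Set Implicit Arguments.
Unset Strict Implicit.
Unset Printing Implicit Defensive.

Import Order.TTheory GRing.Theory Num.Theory.

(** Measure a candidate voltage by the ratios u_i = Vs_i / V_i - 1.  With
    W = S / V = S (1 + u) / Vs, the power flow equation is affine in conj V and W,
    and subtracting the same equation for Vs leaves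

      (1 + conj u_i) (1 + (Z (dS + [S] u))_i) = 1   for all i.

    Expanding, this is conj u + Z [Ss] u + g u = 0, where [ratio_remainder] g
    gathers the constant term, the linear terms that are small with dS, and the
    quadratic term.  Joined to its conjugate it is a system with matrix J, so
    applying the inverse of J turns it into u = F u, with
    F u = - (M conj (g u) + N (g u)) ([ratio_map]).  Conversely a fixed point of F
    solves the product equation ([ratio_map_fixpoint]); that equation itself forces
    1 + u_i != 0, even for r >= 1, so V_i = Vs_i / (1 + u_i) is well defined and
    solves the power flow ([power_flow_ratio]).

    Let a, b, q be the norms that bound the constant, linear and quadratic parts
    of F.  Multiplied by r, the hypothesis says phi r <= r for
    phi t = a + b t + q t^2, so F maps the ball of radius r into itself.  F need not
    be a contraction there (its Lipschitz constant is b + 2 q r), but no topological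
    fixed point theorem is required: by [ratio_map_lip], the increments of the
    iterates of F from 0 are bounded by those of the scalar iterates of phi from
    0, which increase and stay below r.  Hence the iterates of F converge to a fixed
    point in the ball ([majorant_fixpoint]).

    Finally |u_i| <= r gives 1 - r <= |1 + u_i| <= 1 + r, whence the bounds on
    |V_i|. *)

Local Open Scope ring_scope.

(** * Moduli and max-norms *)

Section Norms.
Variable R : realType.
Local Notation C := R[i].

Lemma cmod_ge0 (z : C) : 0 <= cmod z.
Proof. by case: z => a b; exact: sqrtr_ge0. Qed.

Lemma cmodM (z w : C) : cmod (z * w) = cmod z * cmod w.
Proof. exact: Normc.normcM. Qed.

Lemma cmodD (z w : C) : cmod (z + w) <= cmod z + cmod w.
Proof. exact: le_normcD. Qed.

Lemma cmodN (z : C) : cmod (- z) = cmod z.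
Proof. exact: normcN. Qed.

Lemma cmodV (z : C) : cmod z^-1 = (cmod z)^-1.
Proof. exact: Normc.normcV. Qed.

Lemma cmod1 : cmod (1 : C) = 1.
Proof. exact: Normc.normc1. Qed.

Lemma cmod_conj (z : C) : cmod (conjc z) = cmod z.
Proof. by case: z => a b; rewrite /cmod /= sqrrN. Qed.

Lemma cmod_eq0 (z : C) : cmod z = 0 -> z = 0.
Proof. exact: Normc.eq0_normc. Qed.

Lemma normr_Re_le (z : C) : `|complex.Re z| <= cmod z.
Proof. by case: z => a b; rewrite -sqrtr_sqr ler_wsqrtr // lerDl sqr_ge0. Qed.

Lemma normr_Im_le (z : C) : `|complex.Im z| <= cmod z.
Proof. by case: z => a b; rewrite -sqrtr_sqr ler_wsqrtr // lerDr sqr_ge0. Qed.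

Lemma cmod_le_ReIm (z : C) : cmod z <= `|complex.Re z| + `|complex.Im z|.
Proof.
case: z => a b /=; have p := addr_ge0 (normr_ge0 a) (normr_ge0 b).
rewrite -(ger0_norm p) -sqrtr_sqr ler_wsqrtr // sqrrD !real_normK ?num_real //.
by rewrite lerD2r lerDl mulrn_wge0 // mulr_ge0.
Qed.

Lemma cmod_sum_le (I : finType) (f : I -> C) : cmod (\sum_i f i) <= \sum_i cmod (f i).
Proof.
elim/big_ind2: _ => [|x a y b xa yb|//]; first by rewrite /cmod Normc.normc0.
exact: le_trans (cmodD _ _) (lerD xa yb).
Qed.

Lemma cmod_le_vnorm n (x : 'cV[C]_n) i : cmod (x i 0) <= vnorm x.
Proof. exact: (le_bigmax _ (fun i => cmod (x i 0)) i). Qed.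

Lemma vnorm_le n (x : 'cV[C]_n) (c : R) :
  0 <= c -> (forall i, cmod (x i 0) <= c) -> vnorm x <= c.
Proof. by move=> c0 h; apply: bigmax_le. Qed.

Lemma vnorm_ge0 n (x : 'cV[C]_n) : 0 <= vnorm x.
Proof. exact: bigmax_ge_id. Qed.

Lemma vnormD n (x y : 'cV[C]_n) : vnorm (x + y) <= vnorm x + vnorm y.
Proof.
apply: vnorm_le => [|i]; first by rewrite addr_ge0 ?vnorm_ge0.
by rewrite mxE (le_trans (cmodD _ _)) // lerD ?cmod_le_vnorm.
Qed.

Lemma vnormN n (x : 'cV[C]_n) : vnorm (- x) = vnorm x.
Proof. by apply: eq_bigr => i _; rewrite mxE cmodN. Qed.

Lemma vnorm_conj n (x : 'cV[C]_n) : vnorm (conj_entries x) = vnorm x.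
Proof. by apply: eq_bigr => i _; rewrite mxE cmod_conj. Qed.

Lemma vnorm0 n : vnorm (0 : 'cV[C]_n) = 0.
Proof.
apply/eqP; rewrite eq_le vnorm_ge0 andbT; apply: vnorm_le => // i.
by rewrite mxE /cmod Normc.normc0.
Qed.

Lemma vnorm_le0_eq0 n (x : 'cV[C]_n) : vnorm x <= 0 -> x = 0.
Proof.
move=> x0; apply/matrixP => i j; rewrite ord1 mxE; apply: cmod_eq0.
by apply/eqP; rewrite eq_le cmod_ge0 andbT (le_trans (cmod_le_vnorm x i)).
Qed.

Lemma mnorm_ge0 m n (A : 'M[C]_(m, n)) : 0 <= mnorm A.
Proof. exact: bigmax_ge_id. Qed.

Lemma vnorm_mulmx m n (A : 'M[C]_(m, n)) (x : 'cV[C]_n) :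
  vnorm (A *m x) <= mnorm A * vnorm x.
Proof.
apply: vnorm_le => [|i]; first by rewrite mulr_ge0 ?mnorm_ge0 ?vnorm_ge0.
rewrite mxE (le_trans (cmod_sum_le _)) //.
apply: (@le_trans _ _ ((\sum_j cmod (A i j)) * vnorm x)).
  rewrite mulr_suml ler_sum // => j _.
  by rewrite cmodM ler_wpM2l ?cmod_ge0 ?cmod_le_vnorm.
rewrite ler_wpM2r ?vnorm_ge0 //.
exact: (le_bigmax _ (fun i => \sum_j cmod (A i j)) i).
Qed.

(** The norm of [A] bounds the two products together, better than the sum of the
    norms of the two blocks would: the row sums of the blocks add up to a row sum of
    [A] before the maximum over rows is taken. *)
Lemma vnorm_upper_blocks n (A : 'M[C]_(n + n)) (x y : 'cV[C]_n) (c : R) :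
  vnorm x <= c -> vnorm y <= c ->
  vnorm (ulsubmx A *m x + ursubmx A *m y) <= mnorm A * c.
Proof.
move=> xc yc; have c0 := le_trans (vnorm_ge0 x) xc.
have -> : ulsubmx A *m x + ursubmx A *m y = usubmx (A *m col_mx x y).
  by rewrite -{3}(submxK A) mul_block_col col_mxKu.
apply: vnorm_le => [|i]; first by rewrite mulr_ge0 ?mnorm_ge0.
rewrite mxE (le_trans (cmod_le_vnorm _ _)) // (le_trans (vnorm_mulmx _ _)) //.
rewrite ler_wpM2l ?mnorm_ge0 //; apply: vnorm_le => // j.
by rewrite mxE; case: splitP => k _; rewrite (le_trans (cmod_le_vnorm _ _)).
Qed.

Lemma diagcE n (x y : 'cV[C]_n) i : (diagc x *m y) i 0 = x i 0 * y i 0.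
Proof. by rewrite mul_diag_mx !mxE. Qed.

Lemma vnorm_diagc n (x y : 'cV[C]_n) : vnorm (diagc x *m y) <= vnorm x * vnorm y.
Proof.
apply: vnorm_le => [|i]; first by rewrite mulr_ge0 ?vnorm_ge0.
by rewrite diagcE cmodM ler_pM ?cmod_ge0 ?cmod_le_vnorm.
Qed.

Lemma diagcB n (x y : 'cV[C]_n) : diagc (x - y) = diagc x - diagc y.
Proof. by rewrite /diagc !linearB. Qed.

Lemma diagcC n (x y : 'cV[C]_n) : diagc x *m y = diagc y *m x.
Proof. by apply/matrixP => i j; rewrite ord1 !diagcE mulrC. Qed.

Lemma addmxE m n (A B : 'M[C]_(m, n)) i j : (A + B) i j = A i j + B i j.
Proof. by rewrite mxE. Qed.

Lemma oppmxE m n (A : 'M[C]_(m, n)) i j : (- A) i j = - A i j.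
Proof. by rewrite mxE. Qed.

Lemma conj_entriesB m n (A B : 'M[C]_(m, n)) :
  conj_entries (A - B) = conj_entries A - conj_entries B.
Proof. exact: map_mxB. Qed.

Lemma conj_entriesN m n (A : 'M[C]_(m, n)) : conj_entries (- A) = - conj_entries A.
Proof. exact: map_mxN. Qed.

End Norms.

(** * Fixed points by scalar majorants *)

Section Majorant.
Variable R : realType.
Local Notation C := R[i].

(** The increments make [x k + t k] nondecreasing, so its supremum plays the role
    of the limit of [x + t], and [s] that of the limit of [t].  But [s] may be any
    upper bound of [t]: the excess over the true supremum is absorbed by the error
    bound [s - t k]. *)
Lemma dominated_limit (t x : nat -> R) (s : R) :
  (forall k, t k <= s) -> (forall k, `|x k.+1 - x k| <= t k.+1 - t k) ->
  exists l, forall k, `|l - x k| <= s - t k.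
Proof.
move=> ts xt.
have xtn m k : `|x (k + m)%N - x k| <= t (k + m)%N - t k.
  elim: m => [|m IH]; first by rewrite addn0 !subrr normr0.
  rewrite addnS; have := ler_normD (x (k + m).+1 - x (k + m)%N) (x (k + m)%N - x k).
  have := xt (k + m)%N; rewrite subrKA; lra.
pose E := range (fun k => x k + t k).
have ubE k : ubound E (x k - t k + 2 * s).
  move=> _ [m _ <-]; have := ts m; have := ts k.
  case: (leqP k m) => [/subnKC|/ltnW/subnKC] <-.
    by have := xtn (m - k)%N k; rewrite ler_norml => /andP[]; lra.
  by have := xtn (k - m)%N m; rewrite ler_norml => /andP[]; lra.
exists (sup E - s) => k; rewrite ler_norml.
have : x k + t k <= sup E.
  by apply: ub_le_sup; [exists (x k - t k + 2 * s); exact: ubE|exists k].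
have : sup E <= x k - t k + 2 * s.
  by apply: ge_sup; [exists (x k + t k), k|exact: ubE].
by move=> ? ?; apply/andP; split; lra.
Qed.

(** The factor 2 comes from bounding a modulus by the sum of the absolute values
    of the real and imaginary parts; it is harmless when [s] is the supremum of
    [t], since [s - t k] then becomes arbitrarily small. *)
Lemma dominated_vlimit n (t : nat -> R) (x : nat -> 'cV[C]_n) (s : R) :
  (forall k, t k <= s) -> (forall k, vnorm (x k.+1 - x k) <= t k.+1 - t k) ->
  exists u, forall k, vnorm (u - x k) <= 2 * (s - t k).
Proof.
move=> ts xt.
have entry i : exists z : C, forall k, cmod (z - x k i 0) <= 2 * (s - t k).
  have xti k : cmod (x k.+1 i 0 - x k i 0) <= t k.+1 - t k.
    by apply: le_trans (xt k); have := cmod_le_vnorm (x k.+1 - x k) i; rewrite !mxE.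
  have [k|a ha] := @dominated_limit t (fun k => complex.Re (x k i 0)) s ts.
    by apply: le_trans (xti k); have := normr_Re_le (x k.+1 i 0 - x k i 0); rewrite raddfB.
  have [k|b hb] := @dominated_limit t (fun k => complex.Im (x k i 0)) s ts.
    by apply: le_trans (xti k); have := normr_Im_le (x k.+1 i 0 - x k i 0); rewrite raddfB.
  exists (Complex a b) => k; apply: le_trans (cmod_le_ReIm _) _.
  by rewrite !raddfB /=; have := ha k; have := hb k; lra.
have [f hf] := fin_all_exists entry.
exists (\col_i f i) => k; apply: vnorm_le => [|i]; last by rewrite !mxE.
by have := ts k; lra.
Qed.

(** Existence of a fixed point in the ball of radius [r], although the Lipschitz
    constant [b + 2 * q * r] may exceed 1 there.  The iterates of [F] from 0 are
    compared with those of the scalar quadratic [phi]: since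
    [phi t' - phi t = (b + q * (t' + t)) * (t' - t)], the Lipschitz bound propagates
    the inequality between increments from each step to the next. *)
Lemma majorant_fixpoint n (F : 'cV[C]_n -> 'cV[C]_n) (a b q r : R) :
  0 <= b -> 0 <= q -> 0 <= r -> vnorm (F 0) <= a ->
  (forall x y, vnorm (F x - F y) <= (b + q * (vnorm x + vnorm y)) * vnorm (x - y)) ->
  a + b * r + q * r ^+ 2 <= r ->
  exists u, vnorm u <= r /\ F u = u.
Proof.
move=> b0 q0 r0 Fa Flip phir; have a0 := le_trans (vnorm_ge0 _) Fa.
pose phi t := a + b * t + q * t ^+ 2.
have phi_homo t t' : 0 <= t -> t <= t' -> phi t <= phi t'.
  move=> t0 tt'; rewrite /phi lerD ?ler_wpM2l //; first by rewrite lerD2l ler_wpM2l.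
  by rewrite lerXn2r // nnegrE (le_trans t0).
pose t k := iter k phi 0; pose x k := iter k F 0.
have t0 k : 0 <= t k.
  by elim: k => //= k IH; rewrite /phi !addr_ge0 ?mulr_ge0 ?exprn_ge0.
have tr k : t k <= r by elim: k => //= k IH; apply: le_trans phir; apply: phi_homo.
have t_incr k : t k <= t k.+1 by elim: k => [|k IH]; [exact: t0|exact: phi_homo].
have [xt xx] : (forall k, vnorm (x k) <= t k) /\
               (forall k, vnorm (x k.+1 - x k) <= t k.+1 - t k).
  suff H k : vnorm (x k) <= t k /\ vnorm (x k.+1 - x k) <= t k.+1 - t k.
    by split=> k; case: (H k).
  elim: k => [|k [xk xSk]].
    by rewrite vnorm0 lexx; split=> //=; rewrite !subr0 /phi expr0n /= !mulr0 !addr0.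
  have xk1 : vnorm (x k.+1) <= t k.+1.
    by have := vnormD (x k.+1 - x k) (x k); rewrite subrK; lra.
  split=> //; apply: le_trans (Flip _ _) _.
  have -> : t k.+2 - t k.+1 = (b + q * (t k.+1 + t k)) * (t k.+1 - t k).
    have : t k.+1 = phi (t k) by [].
    have -> : t k.+2 = phi (t k.+1) by [].
    rewrite /phi; lra.
  apply: ler_pM => //; rewrite ?vnorm_ge0 //.
    by rewrite addr_ge0 // mulr_ge0 // addr_ge0 ?vnorm_ge0.
  by rewrite lerD2l ler_wpM2l // lerD.
pose s := sup (range t).
have supt : has_sup (range t) by split; [exists (t 0%N), 0%N|exists r => _ [k _ <-]].
have ts k : t k <= s by apply: ub_le_sup; [case: supt|exists k].
have sr : s <= r by apply: ge_sup; [case: supt|move=> _ [k _ <-]].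
(* The error bounds below are multiples of [s - t k], whose infimum is 0. *)
have small d K : 0 <= K -> (forall k, d <= K * (s - t k)) -> d <= 0.
  move=> K0 dK; rewrite leNgt; apply/negP => d0.
  have K1 : 0 < K + 1 by lra.
  have [_ [k _ <-]] := sup_adherent (divr_gt0 d0 K1) supt.
  rewrite -/s ltrBlDl addrC -ltrBlDl ltr_pdivlMr // => st.
  have := dK k; have := ts k; lra.
have [u ux] := dominated_vlimit ts xx.
have ur : vnorm u <= r.
  rewrite -subr_le0; apply: (@small _ 1) => // k.
  have := vnormD (u - x k) (x k); rewrite subrK; have := ux k; have := xt k; lra.
exists u; split=> //; apply/eqP; rewrite -subr_eq0; apply/eqP; apply: vnorm_le0_eq0.
have L0 : 0 <= b + q * (r + r) by rewrite addr_ge0 ?mulr_ge0 ?addr_ge0.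
apply: (@small _ ((b + q * (r + r)) * 2 + 2)) => [|k]; first by rewrite addr_ge0 // mulr_ge0.
(* Compare [F u] and [u] through [F (x k) = x k.+1]. *)
rewrite -(subrKA (F (x k))); apply: le_trans (vnormD _ _) _; rewrite mulrDl lerD //.
  apply: le_trans (Flip _ _) _; rewrite -mulrA ler_pM ?vnorm_ge0 //.
    by rewrite addr_ge0 // mulr_ge0 // addr_ge0 ?vnorm_ge0.
  by rewrite lerD2l ler_wpM2l // lerD // (le_trans (xt k)).
rewrite -opprB vnormN (le_trans (ux k.+1)) // ler_wpM2l // lerB //.
Qed.

End Majorant.

(** * Power flow in terms of the voltage ratios *)

Section PowerFlow.
Variables (R : realType) (n : nat).
Local Notation C := R[i].

Lemma diagc_unit (x : 'cV[C]_n) : (forall i, x i 0 != 0) -> diagc x \in unitmx.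
Proof.
move=> x0; rewrite unitmxE det_diag unitfE; apply/prodf_neq0 => i _.
by rewrite mxE.
Qed.

(** This undoes the definition of [Zmx]: it brings an equation on
    [Zmx Y V *m w] back to the form of the power flow equation. *)
Lemma diagc_Zmx (Y : 'M[C]_n) (V w : 'cV[C]_n) :
  Y \in unitmx -> (forall i, V i 0 != 0) ->
  diagc V *m (conj_entries Y *m (diagc (conj_entries V) *m (Zmx Y V *m w))) = w.
Proof.
move=> uY V0; have uV := diagc_unit V0.
have uVc : diagc (conj_entries V) \in unitmx.
  by apply: diagc_unit => i; rewrite mxE conjc_eq0.
have uYc : conj_entries Y \in unitmx by rewrite map_unitmx.
by rewrite /Zmx -!mulmxA mulKVmx // mulKVmx // mulKVmx.
Qed.

(** With w = Z (dS + [S] u), the product equation says that the relative change of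
    conj V with respect to conj Vs is w, and by the definition of Z this is the
    change needed to carry the currents for Ss at Vs to those for S at V.  A product
    equal to 1 has no zero factor, so the division by 1 + u_i is legitimate. *)
Lemma power_flow_ratio (Y : 'M[C]_n) (v0 : C) (Vs Ss S u : 'cV[C]_n) :
  Y \in unitmx -> (forall i, Vs i 0 != 0) -> power_flow Y v0 Ss Vs ->
  (forall i, (1 + conjc (u i 0)) *
             (1 + (Zmx Y Vs *m (S - Ss + diagc S *m u)) i 0) = 1) ->
  power_flow Y v0 S (\col_i (Vs i 0 / (1 + u i 0))).
Proof.
move=> uY Vs0 Hs; move Ew: (Zmx Y Vs *m _) => w uw.
have cu0 i : 1 + conjc (u i 0) != 0.
  by apply: contra_eq_neq (uw i) => ->; rewrite mul0r eq_sym oner_eq0.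
have u0 i : 1 + u i 0 != 0 by rewrite -conjc_eq0 rmorphD rmorph1 cu0.
set V := \col_i _.
have VVs : conj_entries V - conj_entries Vs = diagc (conj_entries Vs) *m w.
  apply/matrixP => i j; rewrite ord1 diagcE !mxE -/(w i 0) rmorphM /= conjc_inv.
  rewrite rmorphD rmorph1; have <- : 1 + w i 0 = (1 + conjc (u i 0))^-1.
    by apply: (mulfI (cu0 i)); rewrite divff.
  by rewrite mulrDr mulr1 addrAC subrr add0r.
(* The injections scaled by [Vs / V = 1 + u]. *)
have key : diagc Vs *m conj_entries (Y *m (V - const_mx v0)) = S + diagc S *m u.
  move: Hs; rewrite /power_flow !conj_entriesM !conj_entriesB => Hs.
  rewrite -[conj_entries V](subrK (conj_entries Vs)) VVs -addrA.
  rewrite (mulmxDr _ (diagc _ *m w)) mulmxDr Hs.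
  by rewrite -Ew diagc_Zmx // addrAC subrK.
apply/matrixP => i j; rewrite ord1 diagcE.
have := congr1 (fun x : 'cV_n => x i 0) key; rewrite diagcE.
rewrite [RHS]mxE diagcE [V i 0]mxE => e; rewrite mulrAC e.
by rewrite -[X in X + _]mulr1 -mulrDr mulfK.
Qed.

(** What remains of (1 + conj u) (1 + Z (dS + [S] u)) - 1, with S = Ss + dS, once
    the terms conj u + Z [Ss] u, which make up the lower block row of the Jacobian
    J, have been taken out. *)
Definition ratio_remainder (Z : 'M[C]_n) (S dS u : 'cV[C]_n) : 'cV[C]_n :=
  Z *m dS + (Z *m diagc dS) *m u + diagc (Z *m dS) *m conj_entries u
  + diagc (conj_entries u) *m (Z *m diagc S *m u).

Lemma ratio_remainder0 (Z : 'M[C]_n) (S dS : 'cV[C]_n) : ratio_remainder Z S dS 0 = Z *m dS.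
Proof. by rewrite /ratio_remainder /conj_entries map_mx0 !mulmx0 !addr0. Qed.

(** The quadratic part is split as
    conj u (W u) - conj v (W v) = conj u (W (u - v)) + conj (u - v) (W v); the norms
    of [u] and [v] then enter through their sum, the form that the increments of a
    scalar quadratic require. *)
Lemma ratio_remainderB (Z : 'M[C]_n) (S dS u v : 'cV[C]_n) :
  ratio_remainder Z S dS u - ratio_remainder Z S dS v =
    (Z *m diagc dS) *m (u - v) + diagc (Z *m dS) *m conj_entries (u - v)
    + (diagc (conj_entries u) *m (Z *m diagc S *m (u - v))
       + diagc (conj_entries (u - v)) *m (Z *m diagc S *m v)).
Proof.
rewrite /ratio_remainder conj_entriesB diagcB !mulmxBr mulmxBl.
apply/matrixP => i j; rewrite !(addmxE, oppmxE); ring.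
Qed.

Section RatioMap.
Variables (Z : 'M[C]_n) (Ss S : 'cV[C]_n).
Local Notation J := (Jmx Z Ss).
Local Notation M := (Mmx J).
Local Notation N := (Nmx J).
Local Notation dS := (S - Ss).

(** The upper half of [invmx J] applied to minus the remainder, stacked below its
    conjugate. *)
Definition ratio_map (u : 'cV[C]_n) : 'cV[C]_n :=
  - (M *m conj_entries (ratio_remainder Z S dS u)
     + N *m ratio_remainder Z S dS u).

(** The fixed point equation is only the upper half of the system with matrix J;
    its conjugate is the lower half, because the lower blocks of [invmx J] are the
    conjugates of the upper ones.  Multiplying by J and reading off the lower block
    row gives back the product equation. *)
Lemma ratio_map_fixpoint (u : 'cV[C]_n) :
  J \in unitmx -> ratio_map u = u ->
  forall i, (1 + conjc (u i 0)) * (1 + (Z *m (dS + diagc S *m u)) i 0) = 1.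
Proof.
rewrite /ratio_map; set g := ratio_remainder _ _ _ _ => uJ fu i.
have /(congr1 (mulmx J)) :
    col_mx u (conj_entries u) = invmx J *m - col_mx (conj_entries g) g.
  have := congr1 (@conj_entries R n 1) fu.
  rewrite conj_entriesN conj_entriesD !conj_entriesM conj_entriesK addrC => cfu.
  by rewrite invmx_Jmx // mulmxN mul_block_col opp_col_mx fu cfu.
rewrite mulKVmx // /Jmx mul_block_col mul1mx opp_col_mx => /eq_col_mx[_ e].
have := congr1 (fun x : 'cV_n => x i 0) e; rewrite /g /ratio_remainder mul1mx.
rewrite diagcB (mulmxBr Z (diagc S)) mulmxBl [diagc (Z *m _) *m _]diagcC.
rewrite (mulmxDr Z _ (diagc S *m u)) (mulmxA Z).
move: (Z *m dS) (Z *m diagc S *m u) (Z *m diagc Ss *m u) => p q q0.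
rewrite !(addmxE, oppmxE, diagcE) [conj_entries u i 0]mxE.
move=> ei; apply: subr0_eq; move/eqP: ei; rewrite -subr_eq0 => /eqP <-; ring.
Qed.

Lemma ratio_map0 :
  vnorm (ratio_map 0) =
  vnorm (M *m conj_entries Z *m conj_entries dS + N *m Z *m dS).
Proof.
by rewrite /ratio_map ratio_remainder0 vnormN conj_entriesM !mulmxA.
Qed.

(** The linear part of F is split into its conj u and its u terms, whose matrices
    are those of the last two terms of the hypothesis on r; the quadratic part goes
    through [M] and [N] together, which costs the norm of [invmx J]. *)
Lemma ratio_map_lip (u v : 'cV[C]_n) :
  vnorm (ratio_map u - ratio_map v) <=
  (mnorm (M *m conj_entries Z *m diagc (conj_entries dS) + N *m diagc (Z *m dS))
   + mnorm (M *m diagc (conj_entries (Z *m dS)) + N *m Z *m diagc dS)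
   + mnorm (invmx J) * mnorm (Z *m diagc S) * (vnorm u + vnorm v)) * vnorm (u - v).
Proof.
rewrite /ratio_map -opprD vnormN.
rewrite opprD addrACA -!mulmxBr -conj_entriesB ratio_remainderB; move: dS => d.
set q := diagc (conj_entries u) *m _ + _; move: (u - v) @q => w q.
have qle : vnorm q <= mnorm (Z *m diagc S) * (vnorm u + vnorm v) * vnorm w.
  rewrite mulrDr mulrDl; apply: le_trans (vnormD _ _) _; apply: lerD.
    apply: le_trans (vnorm_diagc _ _) _; rewrite vnorm_conj mulrAC mulrC.
    by rewrite ler_wpM2r ?vnorm_ge0 ?vnorm_mulmx.
  apply: le_trans (vnorm_diagc _ _) _; rewrite vnorm_conj mulrC.
  by rewrite ler_wpM2r ?vnorm_ge0 ?vnorm_mulmx.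
clearbody q.
rewrite [X in vnorm X](_ : _ =
   (M *m conj_entries Z *m diagc (conj_entries d) + N *m diagc (Z *m d))
     *m conj_entries w
   + (M *m diagc (conj_entries (Z *m d)) + N *m Z *m diagc d) *m w
   + (M *m conj_entries q + N *m q)); last first.
  rewrite !conj_entriesD (conj_entriesM (Z *m _)) (conj_entriesM (diagc _)).
  rewrite (conj_entriesM Z) !conj_entries_diagc conj_entriesK.
  by rewrite !mulmxDr !mulmxDl !mulmxA; apply/matrixP => i j; rewrite !addmxE; ring.
rewrite !mulrDl; apply: le_trans (vnormD _ _) _; apply: lerD.
  apply: le_trans (vnormD _ _) _; apply: lerD; last exact: vnorm_mulmx.
  by apply: le_trans (vnorm_mulmx _ _) _; rewrite vnorm_conj.
by rewrite -!mulrA; apply: vnorm_upper_blocks; rewrite ?vnorm_conj mulrA.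
Qed.

End RatioMap.

End PowerFlow.

(** * Existence and localization of solutions *)

Theorem theorem2 (R : realType) (n : nat) (Y : 'M[R[i]]_n) (v0 : R[i])
    (Vs Ss : 'cV[R[i]]_n)
    (hY : Y \in unitmx)
    (hVs : forall i : 'I_n, Vs i 0 != 0)
    (hsol : power_flow Y v0 Ss Vs)
    (hJ : Jmx (Zmx Y Vs) Ss \in unitmx)
    (S : 'cV[R[i]]_n) (r : R) (hr : 0 < r) :
  let Z := Zmx Y Vs in
  let J := Jmx Z Ss in
  let M := Mmx J in
  let N := Nmx J in
  let dS := S - Ss in
  r^-1 * vnorm (M *m conj_entries Z *m conj_entries dS + N *m Z *m dS)
    + mnorm (invmx J) * mnorm (Z *m diagc S) * r
    + mnorm (M *m conj_entries Z *m diagc (conj_entries dS) + N *m diagc (Z *m dS))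
    + mnorm (M *m diagc (conj_entries (Z *m dS)) + N *m Z *m diagc dS) <= 1 ->
  (exists V : 'cV[R[i]]_n, power_flow Y v0 S V)
  /\ (r < 1 ->
      exists V : 'cV[R[i]]_n, power_flow Y v0 S V
        /\ forall i : 'I_n,
             cmod (Vs i 0) / (1 + r) <= cmod (V i 0) <= cmod (Vs i 0) / (1 - r)).
Proof.
move=> Z J M N dS hcond.
have [u [ur fu]] : exists u, vnorm u <= r /\ ratio_map Z Ss S u = u.
  have lip := @ratio_map_lip R n Z Ss S.
  apply: (majorant_fixpoint _ _ (ltW hr) (lexx _) lip).
  - by rewrite addr_ge0 ?mnorm_ge0.
  - by rewrite mulr_ge0 ?mnorm_ge0.
  (* The hypothesis multiplied by [r]. *)
  rewrite ratio_map0 -/J -/M -/N -/dS.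
  have := ler_wpM2l (ltW hr) hcond; rewrite mulr1 !mulrDr mulVKf ?gt_eqF //; lra.
have pf := power_flow_ratio hY hVs hsol (ratio_map_fixpoint hJ fu).
split=> [|r1]; first by eexists; exact: pf.
eexists; split=> [|i]; first exact: pf.
rewrite mxE cmodM cmodV.
have uir := le_trans (cmod_le_vnorm u i) ur.
have lo : 1 - r <= cmod (1 + u i 0).
  have := cmodD (1 + u i 0) (- u i 0); rewrite addrK cmod1 cmodN; lra.
have hi : cmod (1 + u i 0) <= 1 + r.
  by apply: le_trans (cmodD _ _) _; rewrite cmod1 lerD2l.
by rewrite !ler_wpM2l ?cmod_ge0 // lef_pV2 ?posrE //; lra.
Qed.
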